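(* Let $p\in(0,1]$, $q\in(0,\infty)$ and $\mathbf u=\{u_n\},\mathbf v=\{v_n\},\mathbf w=\{w_n\}\in\mathbb R_+^{\mathbb Z}$. Define $$A_1=\sup_{\mathbf a\in\mathbb R_+^{\mathbb Z}}\Bigg(\sum_{n\in\mathbb Z}w_n\Big[\sup_{j\ge n}u_j\sup_{i\ge j}a_i\Big]^q\Bigg)^{\frac1q}\Bigg(\sum_{n\in\mathbb Z}v_na_n^p\Bigg)^{-\frac1p},$$ $$A_2=\sup_{\mathbf a\in\mathbb R_+^{\mathbb Z}}\Bigg(\sum_{n\in\mathbb Z}w_n\Big[\sup_{j\ge n}u_j\sum_{i\ge j}a_i\Big]^q\Bigg)^{\frac1q}\Bigg(\sum_{n\in\mathbb Z}v_na_n^p\Bigg)^{-\frac1p},$$ $$A_3=\sup_{\mathbf a\in\mathbb R_+^{\mathbb Z}}\Bigg(\sum_{n\in\mathbb Z}w_n\Big[\sup_{j\ge n}u_j^p\sum_{i\ge j}a_i^p\Big]^{\frac qp}\Bigg)^{\frac1q}\Bigg(\sum_{n\in\mathbb Z}v_na_n^p\Bigg)^{-\frac1p}.$$ Then $A_1$, $A_2$ and $A_3$ are mutually equivalent, and, moreover, the equivalence constants depend only on $p$ and $q$.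
   Context: $\mathbb R_+^{\mathbb Z}$ denotes the set of all double-infinite sequences $\mathbf a=\{a_n\}_{n\in\mathbb Z}$ of nonnegative real numbers. Sums and suprema take values in $[0,\infty]$, with the conventions $0^{-\alpha}=\infty$, $\infty^{-\alpha}=0$ for $\alpha>0$, and $0\cdot\infty=0$. Quantities $A,B\in[0,\infty]$ are equivalent if there are constants $c,C\in(0,\infty)$ (the equivalence constants) with $cA\le B\le CA$. *)

(* Defs.v *)
From mathcomp Require Import all_boot all_order all_algebra.
From mathcomp Require Import all_classical all_reals all_analysis.

Set Implicit Arguments.
Unset Strict Implicit.
Unset Printing Implicit Defensive.

Import Order.TTheory GRing.Theory Num.Theory.

Local Open Scope classical_set_scope.
Local Open Scope ring_scope.
Local Open Scope ereal_scope.

Definition nonneg_seq (R : realType) (a : int -> R) : Prop :=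
  forall n, (0 <= a n)%R.

(* The suprema below are over nonempty sets of nonnegative elements, so
   [ereal_sup], taken in [-oo, +oo], is the supremum taken in [0, +oo]. *)
Definition sup_from (R : realType) (f : int -> \bar R) (n : int) : \bar R :=
  ereal_sup [set f j | j in [set j | (n <= j)%R]].

Definition sum_from (R : realType) (f : int -> \bar R) (n : int) : \bar R :=
  \esum_(i in [set i | (n <= i)%R]) f i.

(* The negative power S^(-1/p) is written (S `^ p^-1)^-1, since the library has
   0^-1 = +oo and +oo^-1 = 0 in \bar R, whereas 0 `^ (- p^-1) = 0 and
   +oo `^ (- p^-1) = +oo there. *)
Definition weighted_norm_inv (R : realType) (p : R) (v a : int -> R) : \bar R :=
  ((\esum_(n in [set: int]) (v n * a n `^ p)%:E) `^ p^-1)^-1.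

Definition A1 (R : realType) (p q : R) (u v w : int -> R) : \bar R :=
  ereal_sup [set
    (\esum_(n in [set: int]) (w n)%:E *
       (sup_from (fun j => (u j)%:E * sup_from (fun i => (a i)%:E) j) n) `^ q)
      `^ q^-1 * weighted_norm_inv p v a
  | a in [set a : int -> R | nonneg_seq a]].

Definition A2 (R : realType) (p q : R) (u v w : int -> R) : \bar R :=
  ereal_sup [set
    (\esum_(n in [set: int]) (w n)%:E *
       (sup_from (fun j => (u j)%:E * sum_from (fun i => (a i)%:E) j) n) `^ q)
      `^ q^-1 * weighted_norm_inv p v a
  | a in [set a : int -> R | nonneg_seq a]].

Definition A3 (R : realType) (p q : R) (u v w : int -> R) : \bar R :=
  ereal_sup [set
    (\esum_(n in [set: int]) (w n)%:E *
       (sup_from (fun j => (u j `^ p)%:E *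
                           sum_from (fun i => (a i `^ p)%:E) j) n) `^ (q / p))
      `^ q^-1 * weighted_norm_inv p v a
  | a in [set a : int -> R | nonneg_seq a]].

Definition equivalent_with (R : realType) (c C : R) (A B : \bar R) : Prop :=
  c%:E * A <= B /\ B <= C%:E * A.

(* Main.v *)
Require Import Defs.
From mathcomp Require Import all_boot all_order all_algebra.
From mathcomp Require Import all_classical all_reals all_analysis.
From mathcomp Require Import finmap lra zify.

(* The inequalities A1 <= A2 <= A3 hold termwise, because
   sup a_i <= sum a_i <= (sum a_i^p)^(1/p). Conversely, put b = a^p. For b
   truncated to a finite range, a greedy scan from right to left produces a
   sequence g with sum v g <= 2 sum v b such that each tail sum of b starting
   at j is at most 2 g_i for some i >= j. Testing A1 with g^(1/p) gives the bound
   A3 <= 4^(1/p) A1 for truncated b, and the general case follows by monotone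
   approximation. *)

Set Implicit Arguments.
Unset Strict Implicit.
Unset Printing Implicit Defensive.

Import Order.TTheory GRing.Theory Num.Theory.

Local Open Scope ring_scope.
Local Open Scope classical_set_scope.

(** * Greedy construction on a finite range *)

(* The indices are scanned in the order [0, 1, 2, ...]. [M] is the largest value
   placed so far, at [t], and [k] the cheapest index seen so far; a new value
   [B], the current partial sum, is placed at [k] as soon as [B] exceeds [2 M].
   The term [2 (B - M) v_k] is the budget saved for that placement. *)
Lemma greedy_invariant (R : realType) (f v : nat -> R) (m : nat) :
  (forall i, 0 <= f i) -> (forall i, 0 <= v i) ->
  exists (g : nat -> R) (M : R) (k t : nat),
    [/\ forall i, 0 <= g i,
        forall i, (m <= i)%N -> g i = 0,
        forall j, (j < m)%N ->
          exists2 i, (i <= j)%N & \sum_(l < j.+1) f l <= 2 * g i,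
        [/\ (k <= m)%N, (t <= m)%N, M <= g t, 0 <= M <= \sum_(i < m) f i &
          \sum_(i < m) f i <= 2 * M] &
        \sum_(i < m) v i * g i + 2 * (\sum_(i < m) f i - M) * v k
          <= 2 * \sum_(i < m) v i * f i].
Proof.
move=> f0 v0;
elim: m => [|m [g [M [k [t [g0 gz gj [km tm Mg /andP[M0 MB] BM] cost]]]]]].
  exists (fun=> 0), 0, 0%N, 0%N; rewrite !big_ord0; split => //; last lra.
  by split => //; lra.
(* The cheapest index is updated before the test, so that a value may be placed at the new index [m]
   itself. *)
have [k' [k'm vk vm]] : exists k', [/\ (k' <= m)%N, v k' <= v k & v k' <= v m].
  by have [vv|/ltW vv] := lerP (v k) (v m); [exists k | exists m].
have fm := f0 m; have vk0 := v0 k'.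
(* Without a placement, [t] serves the index [m], and the budget grows by at most [2 v_m f_m], the
   growth of the right-hand side. *)
have [le2M|gt2M] := lerP (\sum_(i < m.+1) f i) (2 * M).
  exists g, M, k', t; split => //.
  - by move=> i /ltnW; exact: gz.
  - move=> j; rewrite ltnS leq_eqVlt => /orP[/eqP->|/gj//].
    by exists t => //; apply: le_trans le2M _; lra.
  - split; rewrite ?leqW//; rewrite big_ord_recr/=; lra.
  - rewrite !big_ord_recr/= gz// mulr0 addr0; nra.
set B := \sum_(i < m.+1) f i in gt2M *.
have B0 : 0 <= B by exact: sumr_ge0.
have ig i : 0 <= (if i == k' then B else 0) by case: ifP.
(* The placement costs [v k' * B], which the saved budget [2 (B - M) v k'] covers because [B > 2 M];
   the budget then restarts from zero. Adding [B] to [g] instead of overwriting keeps the earlier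
   bounds. *)
exists (fun i => g i + if i == k' then B else 0), B, k', k'; split.
- by move=> i; rewrite addr_ge0.
- move=> i mi; rewrite gz ?(ltnW mi)// add0r gtn_eqF//.
  exact: leq_ltn_trans mi.
- move=> j; rewrite ltnS leq_eqVlt => /orP[/eqP->|/gj[i ij le]].
    by exists k' => //; rewrite eqxx -/B; have := g0 k'; lra.
  by exists i => //; apply: le_trans le _; have := ig i; lra.
- by have := g0 k'; split; rewrite ?leqW ?eqxx//; lra.
- under eq_bigr do rewrite mulrDr.
  rewrite big_split/=.
  have -> : \sum_(i < m.+1) v i * (if (i : nat) == k' then B else 0) = v k' * B.
    rewrite (bigD1 (Ordinal (k'm : (k' < m.+1)%N)))//= eqxx big1 ?addr0// => i.
    by rewrite -val_eqE/= => /negbTE ->; rewrite mulr0.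
  rewrite subrr mulr0 mul0r addr0.
  move: gt2M; rewrite /B !big_ord_recr/= gz// mulr0 addr0 => gt2M.
  nra.
Qed.

(** * Powers and sums, real and extended *)

(** Write [x^r = x x^(r-1)]; as [r - 1 >= 0], both [x^(r-1)] and [y^(r-1)] are at most
    [(x+y)^(r-1)]. *)
Lemma powR_superadditive (R : realType) (r x y : R) :
  1 <= r -> 0 <= x -> 0 <= y -> x `^ r + y `^ r <= (x + y) `^ r.
Proof.
move=> r1 x0 y0; have r0 : 0 < r by lra.
rewrite -(mulr_powRB1 x0 r0) -(mulr_powRB1 y0 r0).
rewrite -(mulr_powRB1 (addr_ge0 x0 y0) r0) mulrDl.
by apply: lerD; apply: ler_wpM2l => //; apply: ge0_ler_powR;
  rewrite ?nnegrE ?subr_ge0 ?lerDl ?lerDr ?addr_ge0.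
Qed.

Lemma sum_powR_le (R : realType) (T : Type) (s : seq T) (f : T -> R) (r : R) :
  1 <= r -> (forall i, 0 <= f i) ->
  \sum_(i <- s) f i `^ r <= (\sum_(i <- s) f i) `^ r.
Proof.
move=> r1 f0; elim: s => [|i s IH]; first by rewrite !big_nil powR_ge0.
rewrite !big_cons; apply: le_trans (powR_superadditive r1 (f0 i) _).
  by rewrite lerD2l.
exact: sumr_ge0.
Qed.

Lemma powRVK (R : realType) (p x : R) : p != 0 -> 0 <= x ->
  (x `^ p^-1) `^ p = x.
Proof. by move=> p0 x0; rewrite -powRrM mulVf// powRr1. Qed.

Local Open Scope ereal_scope.

Lemma lee_poweR (R : realType) (r : R) (x y : \bar R) :
  (0 <= r)%R -> 0 <= x -> x <= y -> x `^ r <= y `^ r.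
Proof.
move=> r0 x0 xy; apply: gt0_ler_poweR => //; rewrite in_itv/= leey andbT//.
exact: le_trans xy.
Qed.

Lemma poweRK (R : realType) (r : R) (x : \bar R) :
  (r != 0)%R -> 0 <= x -> (x `^ r) `^ r^-1 = x.
Proof. by move=> r0 x0; rewrite -poweRrM mulfV// poweRe1. Qed.

Lemma poweRVK (R : realType) (r : R) (x : \bar R) :
  (r != 0)%R -> 0 <= x -> (x `^ r^-1) `^ r = x.
Proof. by move=> r0 x0; rewrite -poweRrM mulVf// poweRe1. Qed.

Lemma esumZl (R : realType) (T : choiceType) (D : set T) (r : R)
    (f : T -> \bar R) : (0 <= r)%R -> (forall i, 0 <= f i) ->
  \esum_(i in D) (r%:E * f i) = r%:E * \esum_(i in D) f i.
Proof.
move=> r0 f0; rewrite /esum -ereal_supZl//; last first.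
  by apply/set0P; exists (\sum_(i \in set0) f i), set0 => //; split.
by rewrite image_comp; congr ereal_sup; apply: eq_imagel => X _ /=;
  rewrite ge0_mule_fsumr.
Qed.

Lemma subset_esum (R : realType) (T : choiceType) (D E : set T)
    (f : T -> \bar R) : D `<=` E -> \esum_(i in D) f i <= \esum_(i in E) f i.
Proof.
move=> DE; apply: ereal_sup_le => _ [X [Xfin XD] <-]; exists X => //.
by split => //; exact: subset_trans DE.
Qed.

(** On finite partial sums this is superadditivity of the power [1/p >= 1], applied to the values
    [a_i^p]. *)
Lemma esum_le_poweR (R : realType) (T : choiceType) (D : set T) (a : T -> R)
    (p : R) : (0 < p)%R -> (p <= 1)%R -> (forall i, (0 <= a i)%R) ->
  \esum_(i in D) (a i)%:E <= (\esum_(i in D) (a i `^ p)%:E) `^ p^-1.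
Proof.
move=> p0 p1 a0; apply/ereal_supP => _ [X [Xfin XD] <-].
apply: (@le_trans _ _ ((\sum_(i \in X) (a i `^ p)%:E) `^ p^-1)); last first.
  apply: lee_poweR; first by rewrite invr_ge0 ltW.
    by apply: fsume_ge0 => i _; rewrite lee_fin powR_ge0.
  by apply: esum_ge; exists X.
rewrite !fsbig_finite// !sumEFin poweR_EFin lee_fin.
under eq_bigr do rewrite -[a _](@powRr1)// -(mulfV (lt0r_neq0 p0)) powRrM.
by apply: sum_powR_le => [|i]; rewrite ?powR_ge0// invf_ge1.
Qed.

(** * Tail suprema, tail sums and the two termwise inequalities *)

Lemma le_sup_from (R : realType) (f : int -> \bar R) (n j : int) :
  (n <= j)%R -> f j <= sup_from f n.
Proof. by move=> nj; apply: ereal_sup_ubound; exists j. Qed.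

Lemma sup_from_le_ub (R : realType) (f : int -> \bar R) (n : int) (M : \bar R) :
  (forall j, (n <= j)%R -> f j <= M) -> sup_from f n <= M.
Proof. by move=> fM; apply/ereal_supP => _ [j nj <-]; exact: fM. Qed.

Lemma sup_from_ge0 (R : realType) (f : int -> \bar R) (n : int) :
  (forall j, 0 <= f j) -> 0 <= sup_from f n.
Proof. by move=> f0; apply: le_trans (f0 n) _; exact: le_sup_from. Qed.

Lemma sum_from_ge0 (R : realType) (f : int -> \bar R) (n : int) :
  (forall j, 0 <= f j) -> 0 <= sum_from f n.
Proof. by move=> f0; apply: esum_ge0. Qed.

Lemma le_sum_from (R : realType) (f g : int -> \bar R) (n : int) :
  (forall j, f j <= g j) -> sum_from f n <= sum_from g n.
Proof. by move=> fg; apply: le_esum => i _; exact: fg. Qed.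

Lemma weighted_norm_inv_ge0 (R : realType) (p : R) (v a : int -> R) :
  0 <= weighted_norm_inv p v a.
Proof. by rewrite /weighted_norm_inv inve_ge0 poweR_ge0. Qed.

Lemma A1_le_A2 (R : realType) (p q : R) (u v w : int -> R) :
  (0 < q)%R -> nonneg_seq u -> nonneg_seq w -> A1 p q u v w <= A2 p q u v w.
Proof.
move=> q0 u0 w0; apply/ereal_supP => _ [a /= a0 <-].
apply: le_trans (ereal_sup_ubound _); last by exists a.
apply: lee_wpmul2r; first exact: weighted_norm_inv_ge0.
have S0 n : 0 <= sup_from (fun j => (u j)%:E * sup_from (fun i => (a i)%:E) j) n.
  by apply: sup_from_ge0 => j; rewrite mule_ge0 ?lee_fin// sup_from_ge0// => i;
    rewrite lee_fin.
apply: lee_poweR; rewrite ?invr_ge0 ?(ltW q0)//.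
  by apply: esum_ge0 => n _; rewrite mule_ge0 ?lee_fin// poweR_ge0.
apply: le_esum => n _; apply: lee_wpmul2l; first by rewrite lee_fin.
apply: lee_poweR => //; first exact: ltW.
apply: sup_from_le_ub => j nj.
apply: le_trans (@le_sup_from _ (fun j => (u j)%:E * sum_from _ j) _ _ nj).
apply: lee_wpmul2l; first by rewrite lee_fin.
(* A single term is the sum over a singleton contained in the tail. *)
apply: sup_from_le_ub => i ji; apply: esum_ge; exists [set i].
  by split => //= _ ->.
by rewrite fsbig_set1.
Qed.

Lemma A2_le_A3 (R : realType) (p q : R) (u v w : int -> R) :
  (0 < p)%R -> (p <= 1)%R -> (0 < q)%R -> nonneg_seq u -> nonneg_seq w ->
  A2 p q u v w <= A3 p q u v w.
Proof.
move=> p0 p1 q0 u0 w0; apply/ereal_supP => _ [a /= a0 <-].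
apply: le_trans (ereal_sup_ubound _); last by exists a.
apply: lee_wpmul2r; first exact: weighted_norm_inv_ge0.
have S0 n : 0 <= sup_from (fun j => (u j)%:E * sum_from (fun i => (a i)%:E) j) n.
  by apply: sup_from_ge0 => j; rewrite mule_ge0 ?lee_fin// sum_from_ge0// => i;
    rewrite lee_fin.
apply: lee_poweR; rewrite ?invr_ge0 ?(ltW q0)//.
  by apply: esum_ge0 => n _; rewrite mule_ge0 ?lee_fin// poweR_ge0.
apply: le_esum => n _; apply: lee_wpmul2l; first by rewrite lee_fin.
(* The exponent [q / p] is split into [1 / p] followed by [q], so only the [1 / p] power of the
   inner supremum has to be compared. *)
rewrite mulrC poweRrM; apply: lee_poweR => //; first exact: ltW.
apply: sup_from_le_ub => j nj.
have s0 i : 0 <= sum_from (fun i => (a i `^ p)%:E) i.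
  by apply: sum_from_ge0 => k; rewrite lee_fin powR_ge0.
apply: (@le_trans _ _ (((u j `^ p)%:E * sum_from (fun i => (a i `^ p)%:E) j) `^ p^-1)).
  rewrite poweRM ?lee_fin ?powR_ge0// -poweR_EFin poweRK ?lee_fin ?gt_eqF//.
  by apply: lee_wpmul2l; rewrite ?lee_fin//; exact: esum_le_poweR.
apply: lee_poweR; rewrite ?invr_ge0 ?(ltW p0)//.
  by rewrite mule_ge0// lee_fin powR_ge0.
exact: (@le_sup_from _ (fun j => (u j `^ p)%:E * sum_from _ j)).
Qed.

(** * The greedy construction on the integers *)

Lemma esum_int_itv (R : realType) (f : int -> \bar R) (N : int) (m : nat) :
  (forall i, 0 <= f i) ->
  \esum_(z in [set z | (N - m%:Z < z <= N)%R]) f z = \sum_(i < m) f (N - i%:Z)%R.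
Proof.
move=> f0.
have -> : [set z | (N - m%:Z < z <= N)%R] = [set (N - i%:Z)%R | i in `I_m].
  apply/seteqP; split => [z /= /andP[lz zN]|_ /= [i im <-]]; last by lia.
  by exists `|N - z|%N; lia.
rewrite esum_image; last by move=> i j _ _ /=; lia.
by rewrite esum_fset// -(fsbig_ord _ m (fun i : nat => f (N - i%:Z)%R)).
Qed.

(** Cutting only to the right of [N] already leaves every tail sum with finitely many nonzero
    terms. *)
Definition truncate (R : realType) (N : int) (f : int -> R) : int -> R :=
  fun i => if (i <= N)%R then f i else 0%R.

(** The reflection [z = N - i] turns the initial sums of the scan into tail sums of the truncated
    sequence, and an index [i <= j] into one to the right of [j]. *)
Lemma greedy (R : realType) (f v : int -> R) (N : int) (m : nat) :
  nonneg_seq f -> nonneg_seq v ->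
  exists g : int -> R, [/\ nonneg_seq g,
    forall j, (N - m%:Z < j)%R -> exists2 i, (j <= i)%R &
      sum_from (fun i => (truncate N f i)%:E) j <= (2 * g i)%:E &
    \esum_(i in [set: int]) (v i * g i)%:E
      <= 2%:E * \esum_(i in [set: int]) (v i * f i)%:E].
Proof.
rewrite /truncate => f0 v0.
have [g [M [k [t [g0 gz gj [_ _ _ /andP[M0 MB] _] cost]]]]] :=
  @greedy_invariant _ (fun i => f (N - i%:Z)%R) (fun i => v (N - i%:Z)%R) m
    (fun i => f0 _) (fun i => v0 _).
exists (fun z => if (z <= N)%R then g `|N - z|%N else 0%R); split.
- by move=> z; case: ifP.
(* To the right of [N] the truncated tail sum is zero, so [j] itself will do. *)
- move=> j mj; have [jN|Nj] := lerP j N; last first.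
    exists j => //; rewrite /sum_from esum1.
      by rewrite lee_fin mulr_ge0//; case: ifP.
    by move=> i /= ji; rewrite lt_geF// (lt_le_trans Nj ji).
  have [|i ij le] := gj `|N - j|%N; first by lia.
  exists (N - i%:Z)%R; first by lia.
  have -> : (N - i%:Z <= N)%R by lia.
  have -> : `|(N - (N - i%:Z))%R|%N = i by lia.
  apply: le_trans (_ : (\sum_(l < `|N - j|%N.+1) f (N - l%:Z)%R)%:E <= _);
    last by rewrite lee_fin.
  rewrite -sumEFin -(@esum_int_itv _ (fun i => (f i)%:E));
    last by move=> ?; rewrite lee_fin.
  rewrite /sum_from esum_mkcond [leRHS]esum_mkcond; apply: le_esum => z _.
  case: ifPn => [/set_mem/= jz|_]; last by case: ifP; rewrite ?lee_fin.
  case: ifPn => [zN|_]; last by case: ifP; rewrite ?lee_fin.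
  by rewrite mem_set//=; lia.
(* The new sequence vanishes outside the window [(N - m, N]], because [g] is zero from [m] on. *)
- apply: (@le_trans _ _ (\esum_(z in [set z | (N - m%:Z < z <= N)%R])
      (v z * if (z <= N)%R then g `|N - z|%N else 0%R)%:E)).
    rewrite [leRHS]esum_mkcond; apply: le_esum => z _.
    have [//|/negP nz] := boolP (z \in _).
    case: ifPn => [zN|_]; last by rewrite mulr0.
    rewrite gz ?mulr0// leqNgt; apply/negP => ?; apply: nz.
    by apply: mem_set => /=; lia.
  rewrite esum_int_itv; last by move=> z; rewrite lee_fin mulr_ge0//; case: ifP.
  apply: (@le_trans _ _ (2%:E *
      \esum_(z in [set z | (N - m%:Z < z <= N)%R]) (v z * f z)%:E)); last first.
    by apply: lee_wpmul2l => //; exact: subset_esum.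
  rewrite esum_int_itv; last by move=> z; rewrite lee_fin mulr_ge0.
  rewrite !sumEFin -EFinM lee_fin.
  rewrite (eq_bigr (fun i : 'I_m => v (N - i%:Z) * g i)%R).
    (* The unspent budget at [k] is nonnegative and is dropped. *)
    have := v0 (N - k%:Z)%R; nra.
  move=> i _; have -> : (N - i%:Z <= N)%R by lia.
  by have -> : `|(N - (N - (i : nat)%:Z))%R|%N = i by lia.
Qed.

(** * Monotone approximation *)

(** A finite partial sum of a tail only involves indices up to some [N], so truncation at that [N]
    leaves it unchanged. *)
Lemma sup_from_le_truncate (R : realType) (U b : int -> R) (n : int) :
  nonneg_seq U -> nonneg_seq b ->
  sup_from (fun j => (U j)%:E * sum_from (fun i => (b i)%:E) j) n
  <= ereal_sup (range (fun N : nat =>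
       sup_from (fun j => (U j)%:E * sum_from (fun i => (truncate N b i)%:E) j) n)).
Proof.
move=> U0 b0; apply: sup_from_le_ub => j nj.
rewrite /sum_from -esumZl//.
apply/ereal_supP => _ [X [Xfin Xj] <-].
have [N XN] : exists N : nat, forall i, X i -> (i <= N%:Z)%R.
  exists (\sum_(i <- fset_set X) `|i|)%N => i Xi.
  have iX : i \in fset_set X by rewrite in_fset_set// mem_set.
  rewrite (big_rem i)//=; lia.
apply: le_trans (ereal_sup_ubound _); last by exists N.
apply: le_trans (@le_sup_from _ (fun j => (U j)%:E * sum_from _ j) _ _ nj).
rewrite /sum_from -esumZl//; last first.
  by move=> i; rewrite /truncate; case: ifP; rewrite lee_fin.
apply: esum_ge; exists X => //.
by apply: lee_fsum => // i Xi; rewrite /truncate XN.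
Qed.

(** Monotone convergence: each term increases to its value at the supremum, so the finite sums
    converge and the uniform bound passes to the limit. *)
Lemma fsum_sup_le (R : realType) (X : set int) (w : int -> R)
    (H : int -> nat -> \bar R) (r : R) (M : \bar R) :
  finite_set X -> (0 < r)%R -> nonneg_seq w -> (forall n N, 0 <= H n N) ->
  (forall n, {homo H n : N N' / (N <= N')%N >-> N <= N'}) ->
  (forall N, \sum_(n \in X) (w n)%:E * H n N `^ r <= M) ->
  \sum_(n \in X) (w n)%:E * ereal_sup (range (H n)) `^ r <= M.
Proof.
move=> Xfin r0 w0 H0 Hnd HM.
(* The power [r] is increasing with inverse the power [1/r], hence commutes with suprema. *)
have powsup n : ereal_sup (range (H n)) `^ r = ereal_sup (range (fun N => H n N `^ r)).
  have sup0 : 0 <= ereal_sup (range (H n)).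
    by apply: le_trans (H0 n 0%N) _; apply: ereal_sup_ubound; exists 0%N.
  apply/eqP; rewrite eq_le; apply/andP; split; last first.
    apply/ereal_supP => _ [N _ <-]; apply: lee_poweR; rewrite ?(ltW r0)//.
    by apply: ereal_sup_ubound; exists N.
  have sup0' : 0 <= ereal_sup (range (fun N => H n N `^ r)).
    apply: (@le_trans _ _ (H n 0%N `^ r)); first exact: poweR_ge0.
    by apply: ereal_sup_ubound; exists 0%N.
  rewrite -[leRHS](@poweRVK _ r) ?gt_eqF//.
  apply: lee_poweR; rewrite ?(ltW r0)//.
  apply/ereal_supP => _ [N _ <-].
  rewrite -[leLHS](@poweRK _ r) ?gt_eqF//.
  apply: lee_poweR; rewrite ?invr_ge0 ?(ltW r0) ?poweR_ge0//.
  by apply: ereal_sup_ubound; exists N.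
have cv : (fun N => \sum_(n <- fset_set X) (w n)%:E * H n N `^ r) N @[N --> \oo]
    --> \sum_(n <- fset_set X) (w n)%:E * ereal_sup (range (H n)) `^ r.
  apply: cvg_nnesum => n _.
    by near=> N; rewrite mule_ge0 ?lee_fin ?poweR_ge0.
  apply: cvgeZl => //; rewrite powsup; apply: ereal_nondecreasing_cvgn.
  by move=> N N' NN; apply: lee_poweR; rewrite ?(ltW r0)//; exact: Hnd.
rewrite fsbig_finite//= -(cvg_lim _ cv)//.
apply: lime_le; first by apply/cvg_ex; eexists; exact: cv.
by near=> N; rewrite -fsbig_finite.
Unshelve. all: by end_near.
Qed.

(** Serves to isolate one factor of a product in [[0, +oo]], so that suprema inside that factor can
    be bounded separately. *)
Lemma mule_le_threshold (R : realType) (W K : \bar R) :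
  0 < W -> 0 <= K -> K < +oo ->
  exists2 M, 0 <= M & forall x, 0 <= x -> (x * W <= K) = (x <= M).
Proof.
(* For [W = +oo] and finite [K], the convention [0 * +oo = 0] admits exactly [x = 0]. *)
case: W => [r| |]//; last first.
  case: K => [k| |]// _ k0 _; exists 0 => // x x0.
  have [->|x_neq0] := eqVneq x 0; first by rewrite mul0e lexx k0.
  have xgt0 : 0 < x by rewrite lt_neqAle eq_sym x_neq0.
  by rewrite gt0_muley// leNgt ltry/= leNgt xgt0.
rewrite lte_fin => r0 K0 _; exists (K * r^-1%:E).
  by rewrite mule_ge0// lee_fin invr_ge0 ltW.
by move=> x _; rewrite lee_pdivlMr.
Qed.

(** * The reverse inequality *)

(** The constant is [2^(1/p)] twice: once from the tail estimate of the greedy sequence, once from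
    its cost. *)
Lemma truncated_bound (R : realType) (p q : R) (u v w a : int -> R)
    (X : set int) (N : nat) :
  (0 < p)%R -> (0 < q)%R -> nonneg_seq u -> nonneg_seq v -> nonneg_seq w ->
  nonneg_seq a -> finite_set X ->
  (\sum_(n \in X) (w n)%:E *
     (sup_from (fun j => (u j `^ p)%:E *
        sum_from (fun i => (truncate N (fun i => a i `^ p)%R i)%:E) j) n)
       `^ (q / p)) `^ q^-1 * weighted_norm_inv p v a
  <= (4 `^ p^-1)%:E * A1 p q u v w.
Proof.
move=> p0 q0 u0 v0 w0 a0 Xfin.
have p_neq0 : (p != 0)%R by rewrite gt_eqF.
have q_neq0 : (q != 0)%R by rewrite gt_eqF.
have pV0 : (0 <= p^-1)%R by rewrite invr_ge0 ltW.
have qV0 : (0 <= q^-1)%R by rewrite invr_ge0 ltW.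
(* The window must start to the left of [X], so that the tail estimate holds at every [j >= n] with
   [n] in [X]. *)
have [m mX] : exists m : nat, forall i, X i -> (N%:Z - m%:Z < i)%R.
  exists (N + (\sum_(i <- fset_set X) `|i|)).+1%N => i Xi.
  have iX : i \in fset_set X by rewrite in_fset_set// mem_set.
  rewrite (big_rem i)//=; lia.
have ap0 : nonneg_seq (fun i => a i `^ p)%R by move=> i; exact: powR_ge0.
have [g [g0 gj cost]] := greedy N m ap0 v0.
set a' := fun i => (g i `^ p^-1)%R.
have a'p i : (a' i `^ p = g i)%R by exact: powRVK.
have a'0 : nonneg_seq a' by move=> i; exact: powR_ge0.
set T := fun n => sup_from (fun j => (u j `^ p)%:E *
  sum_from (fun i => (truncate N (fun i => a i `^ p)%R i)%:E) j) n.
set S := fun n => sup_from (fun j => (u j)%:E * sup_from (fun i => (a' i)%:E) j) n.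
have t0 i : 0 <= (truncate N (fun i => a i `^ p)%R i)%:E.
  by rewrite /truncate; case: ifP; rewrite lee_fin ?powR_ge0.
have T0 n : 0 <= T n.
  by apply: sup_from_ge0 => j; rewrite mule_ge0 ?lee_fin ?powR_ge0 ?sum_from_ge0.
have S0 n : 0 <= S n.
  by apply: sup_from_ge0 => j; rewrite mule_ge0 ?lee_fin// sup_from_ge0// => i;
    rewrite lee_fin.
have TS n : X n -> T n <= 2%:E * S n `^ p.
  move=> Xn; apply: sup_from_le_ub => j nj.
  have [i ji le] := gj j (lt_le_trans (mX _ Xn) nj).
  apply: (@le_trans _ _ ((u j `^ p)%:E * (2 * g i)%:E)).
    by apply: lee_wpmul2l; rewrite ?lee_fin ?powR_ge0.
  (* Here [u_j^p (2 g_i) = 2 (u_j a'_i)^p], and [u_j a'_i] is a competitor in [S n]. *)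
  rewrite -EFinM mulrCA -a'p -powRM// EFinM; apply: lee_wpmul2l => //.
  rewrite -poweR_EFin; apply: lee_poweR; rewrite ?(ltW p0)// ?lee_fin ?mulr_ge0//.
  apply: le_trans (@le_sup_from _ (fun j => (u j)%:E * sup_from _ j) _ _ nj).
  rewrite EFinM; apply: lee_wpmul2l; rewrite ?lee_fin//.
  exact: (@le_sup_from _ (fun i => (a' i)%:E)).
set E1 := \esum_(n in [set: int]) (w n)%:E * S n `^ q.
have E10 : 0 <= E1.
  by apply: esum_ge0 => n _; rewrite mule_ge0 ?lee_fin// poweR_ge0.
have sumTS : (\sum_(n \in X) (w n)%:E * T n `^ (q / p)) `^ q^-1
    <= (2 `^ p^-1)%:E * E1 `^ q^-1.
  have -> : (2 `^ p^-1)%:E = ((2 `^ (q / p))%:E) `^ q^-1 :> \bar R.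
    by rewrite poweR_EFin -powRrM mulrAC mulfV// mul1r.
  rewrite -poweRM ?lee_fin ?powR_ge0//.
  apply: lee_poweR => //.
    by apply: fsume_ge0 => n _; rewrite mule_ge0 ?lee_fin ?poweR_ge0.
  apply: (@le_trans _ _ (\sum_(n \in X) (2 `^ (q / p))%:E * ((w n)%:E * S n `^ q))).
    apply: lee_fsum => // n Xn; rewrite muleCA; apply: lee_wpmul2l; rewrite ?lee_fin//.
    apply: (@le_trans _ _ ((2%:E * S n `^ p) `^ (q / p))).
      by apply: lee_poweR => //; [rewrite divr_ge0 ?(ltW q0) ?(ltW p0)|exact: TS].
    rewrite poweRM ?poweR_ge0 ?lee_fin// poweR_EFin -poweRrM.
    by rewrite mulrCA mulfV// mulr1.
  rewrite -ge0_mule_fsumr => [|n]; last by rewrite mule_ge0 ?lee_fin ?poweR_ge0.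
  apply: lee_wpmul2l; rewrite ?lee_fin ?powR_ge0//.
  by apply: esum_ge; exists X.
have costW : weighted_norm_inv p v a <= (2 `^ p^-1)%:E * weighted_norm_inv p v a'.
  have c0 : (0 < 2 `^ p^-1 :> R)%R by exact: powR_gt0.
  rewrite -lee_pdivrMl// /weighted_norm_inv.
  have n0 f : nonneg_seq f -> 0 <= \esum_(n in [set: int]) (v n * f n)%:E.
    by move=> f0; apply: esum_ge0 => n _; rewrite lee_fin mulr_ge0.
  rewrite -[(_^-1)%:E](_ : ((2 `^ p^-1)%:E)^-1 = _); last by rewrite inver gt_eqF.
  (* The inverse of the product splits because [2^(1/p)] is positive and finite, which excludes the
     form [0 * +oo]. *)
  rewrite -inveM; last first.
    by rewrite inveM_defE eqe gt_eqF//= lee_fin (ltW c0) ltry lte_fin c0 !implybT.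
  rewrite lee_pV2 ?inE ?mule_ge0 ?poweR_ge0 ?lee_fin ?powR_ge0//.
  rewrite -poweR_EFin -poweRM ?n0//.
  apply: lee_poweR => //; first by apply: n0 => i; exact: powR_ge0.
  by under eq_esum do rewrite a'p.
apply: (@le_trans _ _ (((2 `^ p^-1)%:E * E1 `^ q^-1) *
    ((2 `^ p^-1)%:E * weighted_norm_inv p v a'))).
  by apply: lee_pmul => //; rewrite ?poweR_ge0 ?weighted_norm_inv_ge0.
rewrite muleACA -EFinM -powRM// (_ : (2 * 2 = 4 :> R)%R); last by rewrite -natrM.
apply: lee_wpmul2l; first by rewrite lee_fin powR_ge0.
by apply: ereal_sup_ubound; exists a'.
Qed.

Lemma A3_le_A1 (R : realType) (p q : R) (u v w : int -> R) :
  (0 < p)%R -> (0 < q)%R -> nonneg_seq u -> nonneg_seq v -> nonneg_seq w ->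
  A3 p q u v w <= (4 `^ p^-1)%:E * A1 p q u v w.
Proof.
move=> p0 q0 u0 v0 w0; apply/ereal_supP => _ [a /= a0 <-].
have qV0 : (0 <= q^-1)%R by rewrite invr_ge0 ltW.
have K0 : 0 <= (4 `^ p^-1)%:E * A1 p q u v w.
  rewrite mule_ge0 ?lee_fin ?powR_ge0//.
  apply: (@le_trans _ _ _ _ _ _ (ereal_sup_ubound _)); last by exists a.
  by rewrite mule_ge0 ?poweR_ge0 ?weighted_norm_inv_ge0.
have bound X N Xfin := @truncated_bound _ _ _ _ _ _ _ X N p0 q0 u0 v0 w0 a0 Xfin.
have [Kfin|] := ltP ((4 `^ p^-1)%:E * A1 p q u v w) +oo; last first.
  by rewrite leye_eq => /eqP ->; exact: leey.
have [W0|] := ltP 0 (weighted_norm_inv p v a); last first.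
  by move=> W0; rewrite (@le_anti _ _ (weighted_norm_inv p v a) 0) ?mule0//
    W0 weighted_norm_inv_ge0.
(* The cases of an infinite bound and of a zero factor being settled, the claim becomes a bound
   [M^q] on a sum, to be checked on finite partial sums and then on truncations. *)
have [M M0 KM] := mule_le_threshold W0 K0 Kfin.
have t0 N i : 0 <= (truncate N (fun i => a i `^ p)%R i)%:E.
  by rewrite /truncate; case: ifP; rewrite lee_fin ?powR_ge0.
have T0 n (N : nat) : 0 <= sup_from (fun j => (u j `^ p)%:E *
        sum_from (fun i => (truncate N (fun i => a i `^ p)%R i)%:E) j) n.
  by apply: sup_from_ge0 => j; rewrite mule_ge0 ?lee_fin ?powR_ge0 ?sum_from_ge0.
rewrite KM ?poweR_ge0// -[M](@poweRK _ q) ?gt_eqF//.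
have up0 : nonneg_seq (fun j => u j `^ p)%R by move=> ?; exact: powR_ge0.
have ap0 : nonneg_seq (fun j => a j `^ p)%R by move=> ?; exact: powR_ge0.
apply: lee_poweR => //.
  by apply: esum_ge0 => n _; rewrite mule_ge0 ?lee_fin ?poweR_ge0.
apply/ereal_supP => _ [X [Xfin _] <-].
apply: (@le_trans _ _ (\sum_(n \in X) (w n)%:E * ereal_sup (range (fun N : nat =>
     sup_from (fun j => (u j `^ p)%:E *
        sum_from (fun i => (truncate N (fun i => a i `^ p)%R i)%:E) j) n))
       `^ (q / p))).
  apply: lee_fsum => // n Xn; apply: lee_wpmul2l; rewrite ?lee_fin//.
  apply: lee_poweR; first by rewrite divr_ge0 ?ltW.
    by apply: sup_from_ge0 => j; rewrite mule_ge0 ?lee_fin ?sum_from_ge0// => i;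
      rewrite lee_fin.
  exact: sup_from_le_truncate.
apply: fsum_sup_le => //; first by rewrite divr_gt0.
  move=> n N N' NN'; apply: sup_from_le_ub => j nj.
  apply: le_trans (@le_sup_from _ (fun j => (u j `^ p)%:E * sum_from _ j) _ _ nj).
  apply: lee_wpmul2l; rewrite ?lee_fin//; apply: le_sum_from => i.
  rewrite /truncate; case: ifPn => [iN|_]; last by case: ifP; rewrite lee_fin.
  by rewrite ifT//; lia.
move=> N; have := bound X N Xfin; rewrite KM ?poweR_ge0// => le.
rewrite -[leLHS](@poweRVK _ q) ?gt_eqF//; last first.
  by apply: fsume_ge0 => n _; rewrite mule_ge0 ?lee_fin ?poweR_ge0.
by apply: lee_poweR; rewrite ?(ltW q0) ?poweR_ge0.
Qed.

Local Close Scope ereal_scope.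
Local Close Scope classical_set_scope.

Theorem theorem3p7 (R : realType) (p q : R)
    (hp0 : 0 < p) (hp1 : p <= 1) (hq : 0 < q) :
  exists c C : R, [/\ 0 < c, 0 < C &
    forall u v w : int -> R,
      nonneg_seq u -> nonneg_seq v -> nonneg_seq w ->
      [/\ equivalent_with c C (A1 p q u v w) (A2 p q u v w),
          equivalent_with c C (A1 p q u v w) (A3 p q u v w) &
          equivalent_with c C (A2 p q u v w) (A3 p q u v w)]].
Proof.
(* The chain [A1 <= A2 <= A3] gives the lower constant 1; [A3 <= 4^(1/p) A1] closes the cycle and
   supplies every upper bound. *)
exists 1, (4 `^ p^-1); split=> [//||u v w u0 v0 w0]; first exact: powR_gt0.
have A12 := A1_le_A2 p v hq u0 w0.
have A23 := A2_le_A3 v hp0 hp1 hq u0 w0.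
have A31 := A3_le_A1 hp0 hq u0 v0 w0.
have one x : (1%:E * x = x :> \bar R)%E by exact: mul1e.
split; split.
- by rewrite one.
- exact: le_trans A31.
- by rewrite one; exact: le_trans A23.
- exact: A31.
- by rewrite one.
- by apply: le_trans A31 _; apply: lee_wpmul2l; rewrite ?lee_fin ?powR_ge0.
Qed.
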